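(* Let $1\le k\le m$ and $n\ge2$ be integers, and let $\mathcal{G}(k,m)$ be the Grassmannian of $k$-dimensional linear subspaces of $\mathbb{R}^m$. For $V_1,\ldots,V_n\in\mathcal{G}(k,m)$ let $P_i\in L(\mathbb{R}^m,\mathbb{R}^m)$ be the orthogonal projection onto $V_i$, $i=1,\ldots,n$. Then $$d_{\mathcal{G}}(V_1,\ldots,V_n)=\Big(\det\big(\langle P_i,P_j\rangle_{k,H}\big)_{i,j=1}^n\Big)^{1/2}$$ defines a pseudo $n$-metric on $\mathcal{G}(k,m)$.
   Context: For $A,B\in L(\mathbb{R}^m,\mathbb{R}^m)$ (linear maps of $\mathbb{R}^m$), $\langle A,B\rangle_{k,H}=\frac1k\sum_{j=1}^m\langle Ae_j,Be_j\rangle_2$, where $(e_j)_{j=1}^m$ is any orthonormal basis of $\mathbb{R}^m$ and $\langle\cdot,\cdot\rangle_2$ is the Euclidean inner product. For $n\ge2$ and a set $X$, a map $d:X^n\to\mathbb{R}$ is a pseudo $n$-metric on $X$ if (i) $d(x_1,\ldots,x_n)=0$ whenever $x_i=x_j$ for some $i\ne j$; (ii) $d(x_{\pi(1)},\ldots,x_{\pi(n)})=d(x_1,\ldots,x_n)$ for all permutations $\pi$ of $\{1,\ldots,n\}$; (iii) $d(x_1,\ldots,x_n)\le\sum_{i=1}^n d(x_1,\ldots,x_{i-1},y,x_{i+1},\ldots,x_n)$ for all $x_1,\ldots,x_n,y\in X$. *)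

(* Defs.v *)
From HB Require Import structures.
From mathcomp Require Import all_boot all_order all_algebra.
From mathcomp Require Import perm sesquilinear reals.

Set Implicit Arguments.
Unset Strict Implicit.
Unset Printing Implicit Defensive.

Import Order.TTheory GRing.Theory Num.Theory.

Local Open Scope ring_scope.

(* R^m is 'rV[R]_m and L(R^m, R^m) is 'End('rV[R]_m). *)

Definition eucl (R : realType) (m : nat) (u v : 'rV[R]_m) : R :=
  \sum_(i < m) u 0 i * v 0 i.

(* The next three instances make eucl a {dot _ for idfun}, which is what gives
   access to the library's orthogonal complement orthov. *)
Lemma eucl_is_bilinear (R : realType) (m : nat) :
  bilinear_for
    (GRing.Scale.Law.clone _ _ ( *%R ) _)
    (GRing.Scale.Law.clone _ _ (@idfun R \; *%R) _) (@eucl R m).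
Proof.
by split=> [w|w] a u v; rewrite /eucl /= mulr_sumr -big_split /=;
  apply: eq_bigr => i _; rewrite !mxE ?mulrDl ?mulrDr -?mulrA // (mulrCA a).
Qed.

HB.instance Definition _ (R : realType) (m : nat) :=
  bilinear_isBilinear.Build R _ _ _
    (GRing.Scale.Law.clone _ _ ( *%R ) _)
    (GRing.Scale.Law.clone _ _ (@idfun R \; *%R) _)
    (@eucl R m) (@eucl_is_bilinear R m).

Lemma eucl_sym (R : realType) (m : nat) (u v : 'rV[R]_m) :
  eucl u v = (-1) ^+ false * idfun (eucl v u).
Proof. by rewrite mul1r; apply: eq_bigr => i _; rewrite mulrC. Qed.

HB.instance Definition _ (R : realType) (m : nat) :=
  isHermitianSesquilinear.Build R _ false idfun (@eucl R m) (@eucl_sym R m).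

Lemma eucl_gt0 (R : realType) (m : nat) (u : 'rV[R]_m) :
  u != 0 -> 0 < eucl u u.
Proof.
move=> u0; rewrite lt0r sumr_ge0 ?andbT; last first.
  by move=> i _; rewrite -expr2 sqr_ge0.
apply: contraNneq u0 => /eqP.
rewrite psumr_eq0 => [/allP u0|i _]; last by rewrite -expr2 sqr_ge0.
apply/eqP/rowP => i; rewrite mxE.
by have := u0 i (mem_index_enum _); rewrite mulf_eq0 orbb => /eqP.
Qed.

HB.instance Definition _ (R : realType) (m : nat) :=
  isDotProduct.Build R _ (@eucl R m) (@eucl_gt0 R m).

(* The projection onto V along the orthogonal complement of V. *)
Definition orthproj (R : realType) (m : nat) (V : {vspace 'rV[R]_m}) :
  'End('rV[R]_m) := daddv_pi V (orthov (@eucl R m) V).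

Lemma capv_orthov (R : realType) (m : nat) (V : {vspace 'rV[R]_m}) :
  (V :&: orthov (@eucl R m) V = 0)%VS.
Proof.
apply/eqP; rewrite -subv0; apply/subvP => u /memv_capP[uV /mem_orthovP uV'].
rewrite memv0; apply: contraT => /eucl_gt0; by rewrite uV' // ltxx.
Qed.

Lemma addv_orthov (R : realType) (m : nat) (V : {vspace 'rV[R]_m}) :
  (V + orthov (@eucl R m) V = fullv)%VS.
Proof.
pose b (x : 'rV[R]_m) := \row_(i < \dim V) eucl x (vbasis V)`_i.
have b_lin : linear b.
  by move=> a x y; apply/rowP => i; rewrite !mxE linearDl linearZl_LR.
pose L := GRing.isLinear.Build _ _ _ _ b b_lin.
pose bL : {linear 'rV[R]_m -> 'rV[R]_(\dim V)} := HB.pack b L.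
pose f := linfun bL.
have kerf : (lker f <= orthov (@eucl R m) V)%VS.
  apply/subvP => x; rewrite memv_ker lfunE => /eqP /= bx0.
  apply/mem_orthovP => v /coord_vbasis ->; rewrite linear_sumr big1 // => i _.
  by rewrite linearZ /=; move/rowP/(_ i): bx0; rewrite !mxE => ->; rewrite mulr0.
apply/eqP; rewrite eqEdim subvf /= dimv_disjoint_sum ?capv_orthov //.
rewrite -(limg_ker_dim f fullv) capfv addnC leq_add ?dimvS //.
by rewrite (leq_trans (dimvS (subvf _))) // dimvf /dim /= mul1n.
Qed.

(* orthproj V is the orthogonal projection: it maps to V, with residuals
   orthogonal to V. *)
Lemma orthproj_mem (R : realType) (m : nat) (V : {vspace 'rV[R]_m})
    (x : 'rV[R]_m) : orthproj V x \in V.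
Proof. exact: memv_pi. Qed.

Lemma orthproj_orth (R : realType) (m : nat) (V : {vspace 'rV[R]_m})
    (x v : 'rV[R]_m) : v \in V -> eucl (x - orthproj V x) v = 0.
Proof.
move=> vV; have xE := daddv_pi_add (capv_orthov V).
have {}xE := xE x; rewrite addv_orthov memvf in xE.
rewrite -{1}(xE isT) [orthproj V x]/(daddv_pi _ _ _) addrC addKr.
by have /mem_orthovP -> // := memv_pi (orthov (@eucl R m) V) V x.
Qed.

Definition innerkH (R : realType) (k m : nat) (A B : 'End('rV[R]_m)) : R :=
  k%:R^-1 * \sum_(j < m) eucl (A 'e_j) (B 'e_j).

(* innerkH does not depend on the choice of the orthonormal basis. *)
Lemma innerkH_basis (R : realType) (k m : nat) (A B : 'End('rV[R]_m))
    (e : 'I_m -> 'rV[R]_m) :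
  (forall i j, eucl (e i) (e j) = (i == j)%:R) ->
  innerkH k A B = k%:R^-1 * \sum_(j < m) eucl (A (e j)) (B (e j)).
Proof.
move=> e_on; congr (_ * _).
pose E : 'M[R]_m := \matrix_j e j.
have trE (F : 'M[R]_m) : \sum_(j < m) eucl (A (row j F)) (B (row j F)) =
    \tr (F *m (lin1_mx A *m (lin1_mx B)^T) *m F^T).
  apply: eq_bigr => j _.
  rewrite -!mul_rV_lin1 -!row_mul mulmxA -mulmxA -trmx_mul mxE.
  by apply: eq_bigr => i _; rewrite !mxE.
have EE : E *m E^T = 1%:M.
  apply/matrixP => i j; rewrite !mxE -e_on.
  by apply: eq_bigr => l _; rewrite !mxE.
transitivity (\sum_(j < m) eucl (A (row j 1%:M)) (B (row j 1%:M))).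
  by apply: eq_bigr => j _; rewrite row1.
rewrite trE trmx1 mulmx1 mul1mx.
under [RHS]eq_bigr => j _ do rewrite -(rowK e j).
by rewrite trE -/E [RHS]mxtrace_mulC (mulmxA E^T E) (mulmx1C EE) mul1mx.
Qed.

Definition grassmannian (R : realType) (k m : nat) :=
  {V : {vspace 'rV[R]_m} | \dim V == k}.

Definition gram (R : realType) (k m n : nat) (A : 'I_n -> 'End('rV[R]_m)) :
  'M[R]_n := \matrix_(i < n, j < n) innerkH k (A i) (A j).

(* Num.sqrt is 0 on negative numbers; gram_ge0 shows that dG never uses this. *)
Lemma gram_ge0 (R : realType) (k m n : nat) (A : 'I_n -> 'End('rV[R]_m)) :
  0 <= \det (gram k A).
Proof.
set G := gram k A.
have G_ge0 (x : 'rV[R]_n) : 0 <= (x *m G *m x^T) 0 0.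
  suff -> : (x *m G *m x^T) 0 0 =
      k%:R^-1 * \sum_(l < m) eucl (\sum_i x 0 i *: A i 'e_l)
                                  (\sum_i x 0 i *: A i 'e_l).
    rewrite mulr_ge0 ?invr_ge0 ?ler0n // sumr_ge0 // => l _.
    by rewrite sumr_ge0 // => i _; rewrite -expr2 sqr_ge0.
  rewrite mxE mulr_sumr; under eq_bigr => j _ do
    rewrite !mxE mulr_suml.
  under [RHS]eq_bigr => l _ do
    (rewrite linear_sumr mulr_sumr; under eq_bigr => j _ do
      rewrite linear_sumlz mulr_sumr).
  rewrite [RHS]exchange_big; apply: eq_bigr => j _ /=.
  rewrite [RHS]exchange_big; apply: eq_bigr => i _ /=.
  rewrite mxE /innerkH -!mulrA mulrCA; rewrite (mulrC _ (x 0 j)) !mulr_sumr.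
  apply: eq_bigr => l _; rewrite linearZl_LR linearZr_LR /=.
  by rewrite (mulrCA (x 0 i)) (mulrCA (x 0 j)).
rewrite leNgt; apply/negP => G_lt0.
pose H (s : R) : 'M[R]_n := 1%:M + s *: (G - 1%:M).
pose p : {poly R} := \det (1%:M + 'X *: map_mx polyC (G - 1%:M)).
have pE s : p.[s] = \det (H s).
  rewrite -horner_evalE -det_map_mx; congr (\det _).
  by apply/matrixP => i j; rewrite !mxE /= horner_evalE !hornerE hornerMn !hornerE.
have p1 : p.[1] = \det G by rewrite pE /H scale1r addrC subrK.
have p0 : p.[0] = 1 by rewrite pE /H scale0r addr0 det1.
have [||s /andP[s0 s1]] := @poly_ivt R (- p) 0 1; first exact: ler01.
  by rewrite !hornerN p0 p1 oppr_le0 ler01 oppr_ge0 ltW.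
rewrite rootN => /eqP ps.
have {}s1 : s < 1.
  by rewrite lt_neqAle s1 andbT; apply: contraTneq G_lt0 => s1'; rewrite -p1 -s1' ps ltxx.
have /eqP/det0P[x x0 xH] : \det (H s) = 0 by rewrite -pE.
have /matrixP/(_ 0 0) : x *m H s *m x^T = 0 by rewrite xH mul0mx.
have -> : H s = (1 - s)%:M + s *: G.
  by rewrite /H scalerBr addrCA addrC scalemx1 raddfB.
rewrite mulmxDr mulmxDl mul_mx_scalar -scalemxAr -!scalemxAl !mxE => /eqP.
rewrite gt_eqF // ltr_pwDl //; last by have := G_ge0 x; rewrite mxE; exact: mulr_ge0.
rewrite mulr_gt0 ?subr_gt0 //; have := eucl_gt0 x0; congr (0 < _).
by apply: eq_bigr => i _; rewrite !mxE.
Qed.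

Definition dG (R : realType) (k m n : nat) (V : 'I_n -> grassmannian R k m) :
  R := Num.sqrt (\det (gram k (fun i => orthproj (val (V i))))).

(* Points of X^n are functions 'I_n -> X. *)
Definition pseudo_n_metric (R : realType) (n : nat) (X : Type)
    (d : ('I_n -> X) -> R) : Prop :=
  [/\ forall (x : 'I_n -> X) (i j : 'I_n), i != j -> x i = x j -> d x = 0,
      forall (x : 'I_n -> X) (p : 'S_n), d (fun i => x (p i)) = d x
    & forall (x : 'I_n -> X) (y : X),
        d x <= \sum_(i < n) d (fun j => if j == i then y else x j)].

(* Main.v *)
(** For unit vectors [x_1, ..., x_n] with invertible Gram matrix [G] and a unit
    vector [y], write [y = \sum_i c_i x_i + z] with [z] orthogonal to every
    [x_i], and put [s = |z|^2].  Replacing [x_i] by [y] multiplies the Gram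
    determinant by [c_i^2 + s (G^-1)_ii], and [(G^-1)_ii >= 1] because
    [G_ii = 1].  It remains to see that the square roots [t_i] of [c_i^2 + s]
    add up to at least 1, which holds since
    [t_i t_j >= |c_i| |c_j| + s >= c_i c_j G_ij + s] and
    [1 = |y|^2 = \sum_ij c_i c_j G_ij + s].  Orthogonal projections of rank [k]
    are unit vectors for [innerkH k], as their trace is [k]. *)
Require Import Defs.
From mathcomp Require Import all_boot all_order all_algebra.
From mathcomp Require Import reals.
From mathcomp Require Import perm ring lra.

Set Implicit Arguments.
Unset Strict Implicit.
Unset Printing Implicit Defensive.

Import Order.TTheory GRing.Theory Num.Theory.

Local Open Scope ring_scope.

(** * Gram determinants under replacement of one vector *)

Section GramDeterminant.
Variable R : realType.

Definition replace_row (n p : nat) (i : 'I_n) (y : 'rV[R]_p) (X : 'M[R]_(n, p)) :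
  'M[R]_(n, p) := \matrix_(j, l) if j == i then y 0 l else X j l.

Lemma det_replace_row1 (n : nat) (i : 'I_n) (c : 'rV[R]_n) :
  \det (replace_row i c 1%:M) = c 0 i.
Proof.
rewrite (expand_det_col _ i) (bigD1 i) //= big1 ?addr0; last first.
  by move=> j ji; rewrite !mxE (negPf ji) mul0r.
rewrite !mxE eqxx /cofactor -signr_odd oddD addbb expr0 mul1r.
suff -> : row' i (col' i (replace_row i c 1%:M)) = 1%:M by rewrite det1 mulr1.
apply/matrixP => j l.
by rewrite !mxE eq_sym (negPf (neq_lift _ _)) (inj_eq lift_inj).
Qed.

(** Makes row replacement a matrix product, so that multiplicativity of the determinant applies to
    the new Gram matrix. *)
Lemma replace_row_mul (n p : nat) (i : 'I_n) (c : 'rV[R]_n) (X : 'M[R]_(n, p)) :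
  replace_row i c 1%:M *m X = replace_row i (c *m X) X.
Proof.
apply/matrixP => j l; rewrite !mxE.
case: (eqVneq j i) => [->|ji].
  by apply: eq_bigr => h _; rewrite !mxE eqxx.
rewrite (bigD1 j) //= big1 ?addr0; last first.
  by move=> h hj; rewrite !mxE (negPf ji) eq_sym (negPf hj) mul0r.
by rewrite !mxE (negPf ji) eqxx mul1r.
Qed.

(** The cofactors along row [i] do not involve that row, so the determinant is affine in the entry
    at [(i, i)]. *)
Lemma det_add_delta (n : nat) (M : 'M[R]_n) (i : 'I_n) (s : R) :
  \det (M + s *: delta_mx i i) = \det M + s * cofactor M i i.
Proof.
rewrite (expand_det_row _ i) (expand_det_row M i).
have cofE j : cofactor (M + s *: delta_mx i i) i j = cofactor M i j.
  congr (_ * \det _); apply/matrixP => a b.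
  by rewrite !mxE eq_sym (negPf (neq_lift _ _)) mulr0 addr0.
under eq_bigr => j _ do rewrite cofE !mxE eqxx mulrDl.
rewrite big_split /=; congr (_ + _).
rewrite (bigD1 i) //= big1 ?addr0 ?eqxx ?mulr1 // => j ji.
by rewrite (negPf ji) mulr0 mul0r.
Qed.

Lemma cofactor_unit (n : nat) (M : 'M[R]_n) (i : 'I_n) :
  M \in unitmx -> cofactor M i i = \det M * invmx M i i.
Proof.
move=> Mu; rewrite /invmx Mu !mxE mulrA divff ?mul1r //.
by rewrite unitmxE unitfE in Mu.
Qed.

Lemma row_sqr_ge0 (p : nat) (w : 'rV[R]_p) : 0 <= (w *m w^T) 0 0.
Proof. by rewrite mxE sumr_ge0 // => i _; rewrite mxE -expr2 sqr_ge0. Qed.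

Lemma inv_gram_diag_ge1 (n p : nat) (X : 'M[R]_(n, p)) (i : 'I_n) :
  X *m X^T \in unitmx -> (X *m X^T) i i = 1 -> 1 <= invmx (X *m X^T) i i.
Proof.
set G := X *m X^T => Gu Gii.
have Gsym : G^T = G by rewrite trmx_mul trmxK.
pose H := invmx G.
have Hsym : H^T = H by rewrite trmx_inv Gsym.
(* [row i H *m X] is the dual vector of row [i] of [X]: it has product 1 with that row and 0 with
   the others. Its difference from that row has squared norm [H i i - 1]. *)
have := row_sqr_ge0 ((row i H - delta_mx 0 i) *m X).
rewrite trmx_mul mulmxA -(mulmxA _ X) -/G.
rewrite mulmxBl -row_mul mulVmx // linearB /= mulmxBl !mulmxBr.
rewrite tr_row Hsym -mulmxA -rowE trmx_delta.
have -> : row i 1%:M *m col i H = (H i i)%:M :> 'M_1.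
  by apply/matrixP => a b; rewrite !ord1 row1 -rowE !mxE mulr1n.
have -> : row i 1%:M *m delta_mx i 0 = 1%:M :> 'M[R]_1.
  by apply/matrixP => a b; rewrite !ord1 row1 -rowE !mxE !eqxx.
have -> : row i (G *m col i H) = 1%:M :> 'M[R]_1.
  rewrite colE mulmxA mulmxV // mul1mx.
  by apply/matrixP => a b; rewrite !ord1 !mxE !eqxx.
have -> : delta_mx 0 i *m G *m delta_mx i 0 = 1%:M :> 'M[R]_1.
  rewrite -rowE -colE; apply/matrixP => a b.
  by rewrite !ord1 mxE mxE Gii !mxE eqxx.
by rewrite subrr subr0 !mxE mulr1n subr_ge0.
Qed.

(** Cauchy-Schwarz for unit rows: the squared norms of the sum and of the difference of rows [i] and
    [j] are nonnegative. *)
Lemma norm_gram_le1 (n p : nat) (X : 'M[R]_(n, p)) (i j : 'I_n) :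
  (forall l, (X *m X^T) l l = 1) -> `|(X *m X^T) i j| <= 1.
Proof.
move=> X1.
have E (e : R) : 0 <= 1 + e ^+ 2 + 2 * e * (X *m X^T) i j.
  have := row_sqr_ge0 (row i X + e *: row j X).
  suff -> : ((row i X + e *: row j X) *m (row i X + e *: row j X)^T) 0 0 =
    (X *m X^T) i i + e ^+ 2 * (X *m X^T) j j + 2 * e * (X *m X^T) i j.
    by rewrite !X1 mulr1.
  rewrite !mxE !mulr_sumr -!big_split /=; apply: eq_bigr => l _.
  by rewrite !mxE; ring.
have := E 1; have := E (-1); rewrite ler_norml; lra.
Qed.

(** Since [z] is orthogonal to the rows of [X], the cross terms vanish and the new Gram matrix is
    [E *m (X *m X^T) *m E^T] plus the squared norm of [z] at [(i, i)]. The determinant of [E] is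
    [c 0 i]. *)
Lemma det_gram_replace_row (n p : nat) (X : 'M[R]_(n, p)) (c : 'rV[R]_n)
    (z : 'rV[R]_p) (i : 'I_n) :
  X *m X^T \in unitmx -> X *m z^T = 0 ->
  let Y := replace_row i (c *m X + z) X in
  \det (Y *m Y^T) = \det (X *m X^T) *
    (c 0 i ^+ 2 + (z *m z^T) 0 0 * invmx (X *m X^T) i i).
Proof.
move=> Gu zX /=; set Y := replace_row _ _ _.
have zX' : z *m X^T = 0 by rewrite -[z]trmxK -trmx_mul zX trmx0.
pose E := replace_row i c 1%:M.
have YE : Y = E *m X + delta_mx i 0 *m z.
  rewrite replace_row_mul; apply/matrixP => j l; rewrite !mxE big_ord1 !mxE.
  by case: eqP => _; rewrite ?mul1r ?mul0r ?addr0.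
have -> : Y *m Y^T = E *m (X *m X^T) *m E^T + (z *m z^T) 0 0 *: delta_mx i i.
  rewrite YE linearD /= !trmx_mul mulmxDl !mulmxDr.
  rewrite -!mulmxA (mulmxA X) (mulmxA z) zX' mul0mx mulmx0 (mulmxA X z^T) zX.
  rewrite mul0mx !mulmx0 addr0 add0r; congr (_ + _).
  rewrite trmx_delta (mulmxA z) [in LHS](mx11_scalar (z *m z^T)) mul_scalar_mx.
  by rewrite -!scalemxAr mul_delta_mx.
rewrite det_add_delta !det_mulmx det_tr det_replace_row1.
suff -> : cofactor (E *m (X *m X^T) *m E^T) i i =
    \det (X *m X^T) * invmx (X *m X^T) i i by ring.
rewrite -cofactor_unit //; congr (_ * \det _).
(* Deleting row and column [i] leaves only rows on which [E] is the identity. *)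
apply/matrixP => a b; rewrite [LHS]mxE [LHS]mxE [RHS]mxE [RHS]mxE.
have ia h : (h == i) = false -> forall q (A : 'M[R]_(n, q)) l,
    (E *m A) h l = A h l.
  by move=> hi q A l; rewrite replace_row_mul mxE hi.
rewrite -mulmxA ia ?[lift i a == i]eq_sym ?(negPf (neq_lift _ _)) //.
rewrite -[_ *m E^T]trmxK trmx_mul trmxK mxE ia ?mxE //.
by rewrite eq_sym (negPf (neq_lift _ _)).
Qed.

Lemma sum_sqrt_ge1 (n p : nat) (X : 'M[R]_(n, p)) (c : 'rV[R]_n) (s : R) :
  (0 < n)%N -> 0 <= s -> (forall i, (X *m X^T) i i = 1) ->
  (c *m (X *m X^T) *m c^T) 0 0 + s = 1 ->
  1 <= \sum_i Num.sqrt (c 0 i ^+ 2 + s).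
Proof.
move=> n_gt0 s_ge0 X1 cs; set t := fun i => Num.sqrt (c 0 i ^+ 2 + s).
have t_ge0 i : 0 <= t i by rewrite sqrtr_ge0.
suff : 1 ^+ 2 <= (\sum_i t i) ^+ 2.
  by rewrite ler_pXn2r // ?nnegrE ?ler01 // sumr_ge0.
rewrite expr1n expr2.
have tt i j : c 0 i * (X *m X^T) i j * c 0 j + s <= t i * t j.
  apply: (@le_trans _ _ (`|c 0 i| * `|c 0 j| + s)).
    rewrite lerD2r (le_trans (ler_norm _)) // !normrM mulrAC.
    by rewrite ler_piMr ?mulr_ge0 // norm_gram_le1.
  have h l : 0 <= c 0 l ^+ 2 + s by rewrite addr_ge0 ?sqr_ge0.
  (* Both sides become square roots; the radicands differ by [s] times a square. *)
  rewrite -sqrtrM // -[leLHS]ger0_norm ?addr_ge0 ?mulr_ge0 // -sqrtr_sqr.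
  rewrite ler_wsqrtr // -(real_normK (num_real (c 0 i))).
  rewrite -(real_normK (num_real (c 0 j))) -subr_ge0.
  suff -> : (`|c 0 i| ^+ 2 + s) * (`|c 0 j| ^+ 2 + s) -
      (`|c 0 i| * `|c 0 j| + s) ^+ 2 = s * (`|c 0 i| - `|c 0 j|) ^+ 2.
    by rewrite mulr_ge0 ?sqr_ge0.
  by ring.
rewrite mulr_suml.
under eq_bigr => i _ do rewrite mulr_sumr.
apply: le_trans (ler_sum _ (fun i _ => ler_sum _ (fun j _ => tt i j))).
under eq_bigr => i _ do rewrite big_split /= sumr_const card_ord.
rewrite big_split /= sumr_const card_ord -cs lerD //; last first.
  (* Summing [tt] over all pairs counts [s] in total [n * n] times, which is at least once as [n] is
     positive. *)
  by rewrite -mulrnA -{1}[s]mulr1n ler_wpMn2l // muln_gt0 n_gt0.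
rewrite [leRHS]exchange_big mxE ler_sum // => j _ /=.
by rewrite [leLHS]mulrC mxE mxE mulr_sumr ler_sum // => i _; rewrite mulrC.
Qed.

Lemma sqrt_det_gram_simplex (n p : nat) (X : 'M[R]_(n, p)) (y : 'rV[R]_p) :
  (0 < n)%N -> (forall i, (X *m X^T) i i = 1) -> (y *m y^T) 0 0 = 1 ->
  Num.sqrt (\det (X *m X^T)) <=
    \sum_i Num.sqrt (\det (replace_row i y X *m (replace_row i y X)^T)).
Proof.
move=> n_gt0 X1 y1; set G := X *m X^T.
(* In the degenerate case the left side is 0; otherwise [G] is invertible. *)
case: (lerP (\det G) 0) => [/ler0_sqrtr ->|G_gt0].
  by rewrite sumr_ge0 // => i _; rewrite sqrtr_ge0.
have Gu : G \in unitmx by rewrite unitmxE unitfE gt_eqF.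
have [c [z [yE zX]]] : exists c z, y = c *m X + z /\ z *m X^T = 0.
  (* The normal equations: [c *m X] is the orthogonal projection of [y] onto the row space of
     [X]. *)
  pose c := y *m X^T *m invmx G; exists c, (y - c *m X).
  by rewrite addrC subrK mulmxBl -(mulmxA c) mulmxKV // subrr.
have Xz : X *m z^T = 0 by rewrite -[X]trmxK -trmx_mul zX trmx0.
set s := (z *m z^T) 0 0.
have s_ge0 : 0 <= s by exact: row_sqr_ge0.
have cs : (c *m G *m c^T) 0 0 + s = 1.
  rewrite -y1 yE linearD /= mulmxDr !mulmxDl trmx_mul (mulmxA z) zX.
  by rewrite -(mulmxA c X z^T) Xz mulmx0 mul0mx addr0 add0r !mulmxA [RHS]mxE.
apply: (@le_trans _ _ (Num.sqrt (\det G) * \sum_i Num.sqrt (c 0 i ^+ 2 + s))).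
  by rewrite ler_peMr ?sqrtr_ge0 // (sum_sqrt_ge1 n_gt0 s_ge0 X1).
rewrite mulr_sumr ler_sum // => i _; rewrite yE det_gram_replace_row //.
rewrite -(sqrtrM _ (ltW G_gt0)) ler_wsqrtr // ler_pM2l // lerD2l ler_peMr //.
by rewrite inv_gram_diag_ge1.
Qed.

End GramDeterminant.

(** * Orthogonal projections as unit vectors *)

Section Projections.
Variables (R : realType) (k m : nat).
Implicit Types (A B : 'End('rV[R]_m)) (V : {vspace 'rV[R]_m}).

Lemma orthproj_id V (v : 'rV[R]_m) : v \in V -> orthproj V v = v.
Proof. by move=> vV; rewrite /orthproj daddv_pi_id // capv_orthov. Qed.

(** The trace can be computed in a basis of [V], because the image lies in [V]; on [V] the
    projection is the identity. *)
Lemma orthproj_trace V : \sum_j (orthproj V 'e_j) 0 j = (\dim V)%:R.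
Proof.
set P := orthproj V; set b := vbasis V.
transitivity (\sum_(i < \dim V) coord b i (P b`_i)).
  under eq_bigr => j _ do
    rewrite {1}(coord_vbasis (orthproj_mem V 'e_j)) summxE.
  rewrite exchange_big; apply: eq_bigr => i _ /=.
  rewrite [in RHS](row_sum_delta b`_i) !linear_sum /=.
  by apply: eq_bigr => j _; rewrite !linearZ !mxE mulrC.
transitivity (\sum_(i < \dim V) (1 : R)); last by rewrite sumr_const card_ord.
apply: eq_bigr => i _.
rewrite orthproj_id ?vbasis_mem ?mem_nth ?size_tuple //.
by rewrite coord_free ?eqxx // (basis_free (vbasisP V)).
Qed.

(** The residual of ['e_j] is orthogonal to its projection, so the sum of squared norms is the trace
    of the projection, namely [k]. *)
Lemma innerkH_orthproj V :
  (0 < k)%N -> \dim V = k -> innerkH k (orthproj V) (orthproj V) = 1.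
Proof.
move=> k_gt0 dimV; rewrite /innerkH.
have -> : \sum_j eucl (orthproj V 'e_j) (orthproj V 'e_j) = k%:R.
  rewrite -dimV -orthproj_trace; apply: eq_bigr => j _.
  have /eqP := orthproj_orth 'e_j (orthproj_mem V 'e_j).
  rewrite linearBl /= subr_eq0 => /eqP <-.
  rewrite /eucl (bigD1 j) //= big1 ?addr0 => [|i ij]; rewrite !mxE !eqxx.
    by rewrite mul1r.
  by rewrite (negPf ij) mul0r.
by rewrite mulVf // pnatr_eq0 -lt0n.
Qed.

(** The scaling turns [innerkH k] into the standard inner product of flattened matrices, so the
    results on [X *m X^T] apply. *)
Definition vec_kH (A : 'End('rV[R]_m)) : 'rV[R]_(m * m) :=
  (Num.sqrt k%:R)^-1 *: mxvec (lin1_mx A).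

Lemma innerkH_vec A B : innerkH k A B = (vec_kH A *m (vec_kH B)^T) 0 0.
Proof.
rewrite /vec_kH linearZ /= -scalemxAl -scalemxAr scalerA mxE.
rewrite -expr2 exprVn sqr_sqrtr ?ler0n // /innerkH; congr (_ * _).
rewrite mxE (reindex _ (curry_mxvec_bij _ _)) /= pair_bigA /=.
by apply: eq_bigr => -[j l] _; rewrite !mxE !mxvecE !mxE.
Qed.

Lemma gram_vec (n : nat) (A : 'I_n -> 'End('rV[R]_m)) :
  let X := \matrix_i vec_kH (A i) in gram k A = X *m X^T.
Proof.
apply/matrixP => i j; rewrite mxE innerkH_vec !mxE.
by apply: eq_bigr => l _; rewrite !mxE.
Qed.

End Projections.

Theorem proposition4p6 (R : realType) (k m n : nat)
    (k_gt0 : (1 <= k)%N) (k_le_m : (k <= m)%N) (n_ge2 : (2 <= n)%N) :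
  @pseudo_n_metric R n (grassmannian R k m) (@dG R k m n).
Proof.
split=> [x i j ij xij|x p|x y].
- rewrite /dG (determinant_alternate ij) ?sqrtr0 // => l.
  by rewrite !mxE xij.
- rewrite /dG; congr Num.sqrt; set G := gram k (fun i => orthproj (val (x i))).
  (* Rows and columns are permuted alike, so the sign of [p] enters twice. *)
  transitivity (\det (row_perm p (col_perm p G))).
    by congr (\det _); apply/matrixP => i j; rewrite !mxE.
  rewrite row_permE col_permE !det_mulmx !det_perm odd_permV mulrCA.
  by rewrite -expr2 sqrr_sign mulr1.
pose v (V : grassmannian R k m) := vec_kH k (orthproj (val V)).
have v1 V : (v V *m (v V)^T) 0 0 = 1.
  by rewrite -innerkH_vec innerkH_orthproj //; apply/eqP/(valP V).
pose X := \matrix_i v (x i).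
have X1 i : (X *m X^T) i i = 1.
  by rewrite -gram_vec mxE innerkH_vec v1.
have := sqrt_det_gram_simplex (ltnW n_ge2) X1 (v1 y).
rewrite /dG gram_vec; congr (_ <= _); apply: eq_bigr => i _.
rewrite gram_vec; congr (Num.sqrt (\det (_ *m _^T))).
all: by apply/matrixP => j l; rewrite !mxE; case: eqP.
Qed.
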